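(* Let $f:B^n\to B$ and let $\mathbf{x}$ be a transient vector. If $P$ is a directed path in $D_f(\mathbf{x})$ from $\alpha(\mathbf{x})$ to $\mathbf{x}$, then $W(P)$ is a walk in $C_f$ and $c_P=c_{W(P)}$. If $W=w^1,\ldots,w^r$ is a walk in $C_f$ and $\mathbf{x}=w^1\circ\cdots\circ w^r$, then $P(W)$ is a directed path in $D_f(\mathbf{x})$ from $\alpha(\mathbf{x})$ to $\mathbf{x}$ and $c_W=c_{P(W)}$. Moreover, $P(W(P))=P$ for every such path $P$ in $D_f(\mathbf{x})$, and $W(P(W))=W$ for every walk $W$ in $C_f$.
   Context: $B=\{0,1\}$. A transient is a nonempty word $t_1\cdots t_m$ over $B$ in which consecutive letters differ; $\alpha$, $\omega$ give its first and last letters. The contraction of a nonempty binary word deletes every letter equal to the letter immediately preceding it; for transients $\mathbf{s},\mathbf{t}$, $\mathbf{s}\circ\mathbf{t}$ is the contraction of the concatenation $\mathbf{s}\mathbf{t}$. A transient vector is an $n$-tuple of transients; $\alpha,\omega$ and $\circ$ are applied componentwise, and a binary vector $w\in B^n$ is regarded as the transient vector whose components have length 1. $D_f(\mathbf{x})$: vertices are the prefixes of $\mathbf{x}$ (vectors of nonempty prefixes of the components); arcs go from $\mathbf{u}$ to $\mathbf{v}$ when $\mathbf{v}$ arises from $\mathbf{u}$ by appending one letter to exactly one component; $\lambda(\mathbf{v})=f(\omega(\mathbf{v}))$. For a path $P=\mathbf{v}^1,\ldots,\mathbf{v}^r$, $c_P$ is the number of $i\in\{1,\ldots,r-1\}$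 with $\lambda(\mathbf{v}^i)=\lambda(\mathbf{v}^{i+1})$. $C_f$: the boolean $n$-cube with vertex set $B^n$, two vertices adjacent iff they differ in exactly one coordinate, vertex $v$ labelled $f(v)$. A walk $W=w^1,\ldots,w^r$ is a sequence of vertices with consecutive ones adjacent; $c_W$ is the number of $j\in\{1,\ldots,r-1\}$ with $f(w^j)=f(w^{j+1})$. For a path $P=\mathbf{v}^1,\ldots,\mathbf{v}^r$ in $D_f(\mathbf{x})$, $W(P)=\omega(\mathbf{v}^1),\ldots,\omega(\mathbf{v}^r)$. For a walk $W=w^1,\ldots,w^r$ in $C_f$, $P(W)=w^1,\ w^1\circ w^2,\ \ldots,\ w^1\circ\cdots\circ w^r$. *)

(* Defs.v *)
From HB Require Import structures.
From mathcomp Require Import all_boot.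
Set Implicit Arguments.
Unset Strict Implicit.
Unset Printing Implicit Defensive.

Definition is_transient (s : seq bool) : bool :=
  (s != [::]) && sorted (fun a b => a != b) s.

Record transient := Transient { tword :> seq bool; _ : is_transient tword }.

HB.instance Definition _ := [isSub for tword].
HB.instance Definition _ := [Choice of transient by <:].

Lemma transientP (t : transient) : is_transient t.
Proof. by case: t. Qed.

(* The defaults of [head] and [last] are never reached: transients are
   nonempty. *)
Definition first_letter (t : transient) : bool := head false t.
Definition last_letter (t : transient) : bool := last false t.

(* [zip (a :: s') s'] lists the pairs (preceding letter, letter) of the original
   word [a :: s']. *)
Definition contraction (s : seq bool) : seq bool :=
  if s is a :: s' then a :: [seq p.2 | p <- zip s s' & p.1 != p.2] else [::].

Lemma contraction_transient (s : seq bool) :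
  s != [::] -> is_transient (contraction s).
Proof.
case: s => [//|a s] _; rewrite /is_transient /=.
elim: s a => [//|b s IHs] a /=.
by case: (boolP (a != b)) => [ab /=|/negPn/eqP ->]; rewrite ?ab ?IHs.
Qed.

Lemma circ_subproof (s t : transient) : is_transient (contraction (s ++ t)).
Proof.
apply: contraction_transient.
by case: s => [[|a s]].
Qed.

Definition circ (s t : transient) : transient := Transient (circ_subproof s t).

Lemma letter_subproof (b : bool) : is_transient [:: b].
Proof. by []. Qed.

Definition letter (b : bool) : transient := Transient (letter_subproof b).

Notation cube n := {ffun 'I_n -> bool}.
Notation tvector n := {ffun 'I_n -> transient}.

Section Vectors.

Variable n : nat.
Implicit Types (u v x : tvector n) (w : cube n).

Definition alpha x : cube n := [ffun i => first_letter (x i)].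
Definition omega x : cube n := [ffun i => last_letter (x i)].
Definition vcirc u v : tvector n := [ffun i => circ (u i) (v i)].
Definition embed w : tvector n := [ffun i => letter (w i)].

(* Vertices and arcs of D_f(x); [f] only enters through the labels. *)
Definition dvertex x u : bool := [forall i, prefix (u i) (x i)].

Definition darc u v : bool :=
  [exists i, exists b : bool, forall j,
     (v j : seq bool) == (if j == i then rcons (u j) b else u j)].

Definition dlabel (f : cube n -> bool) v : bool := f (omega v).

Definition dpath x u v (P : seq (tvector n)) : bool :=
  if P is p :: P' then
    [&& p == u, last p P' == v, all (dvertex x) P, path darc p P' & uniq P]
  else false.

Definition cube_adj (w1 w2 : cube n) : bool := #|[set i | w1 i != w2 i]| == 1.

Definition cwalk (W : seq (cube n)) : bool := (W != [::]) && sorted cube_adj W.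

Definition walk_of_path (P : seq (tvector n)) : seq (cube n) := map omega P.

(* Products associate to the left: ((w^1 o w^2) o ...) o w^r for the nonempty
   sequence w^1 :: ws. *)
Definition vcirc_seq w (ws : seq (cube n)) : tvector n :=
  foldl (fun u w' => vcirc u (embed w')) (embed w) ws.

Definition path_of_walk (W : seq (cube n)) : seq (tvector n) :=
  if W is w :: ws then
    embed w :: scanl (fun u w' => vcirc u (embed w')) (embed w) ws
  else [::].

End Vectors.

(* c_P and c_W: the number of consecutive pairs with equal labels. *)
Definition repeats (T : Type) (lab : T -> bool) (s : seq T) : nat :=
  count (fun p => lab p.1 == lab p.2) (zip s (behead s)).

(* Main.v *)
(* Appending a letter to a transient appends it as a word exactly when it
   differs from the last letter, and in every case makes it the last letter.
   Hence the arcs leaving u in D_f(x) are exactly u -> u o w with w adjacent to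
   omega(u), and omega(u o w) = w.  So omega and the partial products are
   inverse to each other step by step, and labels agree because
   lambda = f o omega. *)
Require Import Defs.
From mathcomp Require Import all_boot.

Set Implicit Arguments.
Unset Strict Implicit.
Unset Printing Implicit Defensive.

(** The pairs (preceding letter, letter) of the longer word are those of [a :: s] followed by
    [(last a s, b)], and the filter keeps this last pair exactly when its letters differ. *)
Lemma contraction_rcons (a b : bool) (s : seq bool) :
  contraction (rcons (a :: s) b) =
  if last a s == b then contraction (a :: s)
  else rcons (contraction (a :: s)) b.
Proof.
rewrite /=; suff -> : [seq p.2 | p <- zip (a :: rcons s b) (rcons s b)
    & p.1 != p.2] = [seq p.2 | p <- zip (a :: s) s & p.1 != p.2]
    ++ (if last a s == b then [::] else [:: b]).
  by case: ifP => _; rewrite ?cats0 // cats1.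
elim: s a => [|c s IHs] a /=; first by case: (a == b).
by case: (a != c); rewrite /= IHs.
Qed.

Lemma contraction_id (s : seq bool) : is_transient s -> contraction s = s.
Proof.
case: s => // a s; rewrite /is_transient /= => s_alt; congr (_ :: _).
by elim: s a s_alt => //= b s IHs a /andP[-> /IHs /= ->].
Qed.

Lemma transient_cons (t : transient) : exists a s, t = a :: s :> seq bool.
Proof. by case: t => [[|a s] // ?]; exists a, s. Qed.

Lemma circ_letter (t : transient) (b : bool) :
  circ t (letter b) = (if last_letter t == b then t : seq bool else rcons t b)
    :> seq bool.
Proof.
have t_id := contraction_id (transientP t).
have [a [s Et]] := transient_cons t.
rewrite /last_letter [LHS]/= cats1 Et contraction_rcons -Et t_id.
by rewrite Et.
Qed.

Lemma circ_letter_last (t : transient) : circ t (letter (last_letter t)) = t.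
Proof. by apply: val_inj; rewrite [LHS]circ_letter eqxx. Qed.

Lemma last_letter_circ (t : transient) (b : bool) :
  last_letter (circ t (letter b)) = b.
Proof.
by rewrite {1}/last_letter circ_letter; case: eqP => // _; rewrite last_rcons.
Qed.

(** Consecutive letters of [t] differ, up to and including the appended one. This is why an arc
    flips the last letter of the component it extends, and so projects to an edge of the cube. *)
Lemma last_letter_rcons (s t : transient) (b : bool) :
  t = rcons s b :> seq bool -> last_letter t = b /\ last_letter s != b.
Proof.
move=> Et; have [a [s' Es]] := transient_cons s.
rewrite /last_letter Et last_rcons; split => //.
have := transientP t; rewrite Et Es /is_transient /= rcons_path.
by case/andP.
Qed.

Lemma darcP (n : nat) (u v : tvector n) :
  reflect (exists i b, forall j,
             v j = (if j == i then rcons (u j) b else u j) :> seq bool)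
          (darc u v).
Proof.
apply: (iffP existsP) => [[i /existsP[b /forallP uv]]|[i [b uv]]].
  by exists i, b => j; apply/eqP.
by exists i; apply/existsP; exists b; apply/forallP => j; apply/eqP.
Qed.

Lemma cube_adjP (n : nat) (w1 w2 : cube n) :
  reflect (exists i, forall j, (w1 j != w2 j) = (j == i)) (cube_adj w1 w2).
Proof.
apply: (iffP cards1P) => [[i /setP E]|[i E]]; exists i.
  by move=> j; have := E j; rewrite !inE.
by apply/setP => j; rewrite !inE.
Qed.

Section Vectors.

Variable n : nat.
Implicit Types (u v x : tvector n) (w : cube n).

Lemma omega_embed w : omega (embed w) = w.
Proof. by apply/ffunP => i; rewrite !ffunE. Qed.

Lemma omega_vcirc_embed u w : omega (vcirc u (embed w)) = w.
Proof. by apply/ffunP => i; rewrite !ffunE last_letter_circ. Qed.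

Lemma darc_vcirc u w : cube_adj (omega u) w -> darc u (vcirc u (embed w)).
Proof.
case/cube_adjP => i uw; apply/darcP; exists i, (w i) => j.
(* Negating the test of [circ_letter] makes it the left side of [uw j], so that it can be replaced
   by [j == i]. *)
rewrite !ffunE circ_letter; have := uw j; rewrite ffunE -if_neg => ->.
by case: eqP => // ->.
Qed.

Lemma darc_omega u v : darc u v -> cube_adj (omega u) (omega v).
Proof.
case/darcP => i [b uv]; apply/cube_adjP; exists i => j; rewrite !ffunE.
have := uv j; case: eqP => _; first by case/last_letter_rcons => ->.
by move/val_inj => ->; rewrite eqxx.
Qed.

(** Away from the extended component, [omega v] repeats the last letter of [u], which contraction
    absorbs; at that component the letter is new and gets appended. *)
Lemma darc_vcircE u v : darc u v -> vcirc u (embed (omega v)) = v.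
Proof.
case/darcP => i [b uv]; apply/ffunP => j; rewrite !ffunE.
have := uv j; case: eqP => _ Ev; last first.
  by rewrite (val_inj Ev) circ_letter_last.
apply: val_inj; have [-> /negPf nb] := last_letter_rcons Ev.
by rewrite [LHS]circ_letter nb.
Qed.

Lemma dvertex_refl u : dvertex u u.
Proof. by apply/forallP => i; apply: prefix_refl. Qed.

Lemma dvertex_darc x u v : darc u v -> dvertex x v -> dvertex x u.
Proof.
case/darcP => i [b uv] /forallP xv; apply/forallP => j.
apply: prefix_trans (xv j); rewrite uv.
by case: eqP => _; [apply: prefix_rcons | apply: prefix_refl].
Qed.

(** Arcs only lengthen components, so a sequence of arcs ending at [x] stays among the prefixes of
    [x]. *)
Lemma dpath_dvertex u s :
  path (@darc n) u s -> all (dvertex (last u s)) (u :: s).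
Proof.
elim: s u => [|v s IHs] u; first by rewrite /= dvertex_refl.
case/andP => uv /IHs xs; rewrite [last _ _]/= [all _ _]/= -/(all _ (v :: s)) xs.
by rewrite (dvertex_darc uv) //; case/andP: xs.
Qed.

(** A one-letter prefix fixes the first letter. This identifies the source of a path built from a
    walk. *)
Lemma alpha_dvertex_embed x w : dvertex x (embed w) -> alpha x = w.
Proof.
move/forallP => xw; apply/ffunP => i; have := xw i; rewrite !ffunE.
by rewrite /first_letter; case: (tword (x i)) => //= a s /andP[/eqP ->].
Qed.

(** A potential that strictly increases along arcs; it gives the absence of repeated vertices that
    [dpath] demands. *)
Definition total_length u : nat := \sum_i size (u i).

Lemma total_length_darc u v : darc u v -> total_length u < total_length v.
Proof.
case/darcP => i [b uv]; rewrite /total_length (bigD1 i) //= [ltnRHS](bigD1 i) //=.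
rewrite uv eqxx size_rcons addSn ltnS leq_add2l leq_sum // => j /negPf ji.
by rewrite uv ji.
Qed.

Lemma dpath_uniq u s : path (@darc n) u s -> uniq (u :: s).
Proof.
move=> us; apply: (sorted_uniq (leT := relpre total_length ltn)).
- by move=> y z t; apply: ltn_trans.
- by move=> y; apply: ltnn.
- exact: sub_path total_length_darc _ _ us.
Qed.

Lemma omega_scanl u ws :
  map (@omega n) (scanl (fun u w => vcirc u (embed w)) u ws) = ws.
Proof. by elim: ws u => //= w ws IHws u; rewrite omega_vcirc_embed IHws. Qed.

Lemma scanl_omega u s : path (@darc n) u s ->
  scanl (fun u w => vcirc u (embed w)) u (map (@omega n) s) = s.
Proof. by elim: s u => //= v s IHs u /andP[/darc_vcircE -> /IHs ->]. Qed.

Lemma scanl_darc u ws : path (@cube_adj n) (omega u) ws ->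
  path (@darc n) u (scanl (fun u w => vcirc u (embed w)) u ws).
Proof.
elim: ws u => //= w ws IHws u /andP[/darc_vcirc -> ws_walk].
by apply: IHws; rewrite omega_vcirc_embed.
Qed.

Lemma walk_of_pathK (W : seq (cube n)) : walk_of_path (path_of_walk W) = W.
Proof. by case: W => //= w ws; rewrite omega_embed [walk_of_path _]omega_scanl. Qed.

Lemma repeats_walk_of_path (f : cube n -> bool) (P : seq (tvector n)) :
  repeats (dlabel f) P = repeats f (walk_of_path P).
Proof.
rewrite /repeats; case: P => //= p P.
by elim: P p => //= q P IHP p; rewrite IHP.
Qed.

Lemma cwalk_walk_of_path x u v P : dpath x u v P -> cwalk (walk_of_path P).
Proof.
case: P => // p P /and5P[_ _ _ pP _]; rewrite /cwalk /= path_map.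
exact: sub_path darc_omega _ _ pP.
Qed.

(** [path_of_walk] restarts from one-letter components, so the source [embed w] is recovered from
    its last letters; each later vertex is recovered by [darc_vcircE]. *)
Lemma path_of_walkK x w v P :
  dpath x (embed w) v P -> path_of_walk (walk_of_path P) = P.
Proof.
case: P => // p P /and5P[/eqP -> _ _ pP _].
by rewrite /= omega_embed scanl_omega.
Qed.

Lemma dpath_path_of_walk w ws (x := vcirc_seq w ws) : cwalk (w :: ws) ->
  dpath x (embed (alpha x)) x (path_of_walk (w :: ws)).
Proof.
case/andP => _ ws_walk; rewrite /path_of_walk.
have := @scanl_darc (embed w) ws; rewrite omega_embed => /(_ ws_walk).
(* The last partial product is the full left fold; the induction lets the accumulator vary. *)
have : last (embed w) (scanl (fun u w => vcirc u (embed w)) (embed w) ws) = x.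
  by rewrite /x /vcirc_seq; elim: ws (embed w) {x ws_walk} => //=.
set s := scanl _ _ _ => lastx ws_path.
have := dpath_dvertex ws_path; rewrite lastx => xs.
have /alpha_dvertex_embed -> : dvertex x (embed w) by case/andP: xs.
by apply/and5P; split; rewrite ?lastx ?dpath_uniq.
Qed.

End Vectors.

Theorem theorem2 (n : nat) (f : cube n -> bool) :
  [/\ forall (x : tvector n) (P : seq (tvector n)),
        dpath x (embed (alpha x)) x P ->
        cwalk (walk_of_path P) /\
        repeats (dlabel f) P = repeats f (walk_of_path P),
      forall (w : cube n) (ws : seq (cube n)) (x : tvector n),
        cwalk (w :: ws) -> x = vcirc_seq w ws ->
        dpath x (embed (alpha x)) x (path_of_walk (w :: ws)) /\
        repeats f (w :: ws) = repeats (dlabel f) (path_of_walk (w :: ws)),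
      forall (x : tvector n) (P : seq (tvector n)),
        dpath x (embed (alpha x)) x P ->
        path_of_walk (walk_of_path P) = P
    & forall W : seq (cube n),
        cwalk W -> walk_of_path (path_of_walk W) = W].
Proof.
split.
- move=> x P xP; split; first exact: cwalk_walk_of_path xP.
  exact: repeats_walk_of_path.
- move=> w ws x ws_walk ->; split; first exact: dpath_path_of_walk.
  (* The counts agree by the path case applied to [path_of_walk (w :: ws)], whose walk is [w :: ws]
     again. *)
  by rewrite repeats_walk_of_path walk_of_pathK.
- by move=> x P /path_of_walkK.
- by move=> W _; apply: walk_of_pathK.
Qed.
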